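(* Let $\mathbb{K}\in\{\mathbb{R},\mathbb{C}\}$ be the scalar field. The one-dimensional space $\mathbb{K}$ is the only finite-dimensional Banach space over $\mathbb{K}$ (up to isometric isomorphism) which has the super alternative Daugavet property. Moreover, $\mathbb{K}$ is the only Banach space with the super alternative Daugavet property which has the Kadec property.
   Context: Banach spaces are non-zero and over $\mathbb{K}$ ($\mathbb{R}$ or $\mathbb{C}$); $B_X$, $S_X$ denote the closed unit ball and the unit sphere of $X$; $\mathbb{T}=\{\theta\in\mathbb{K}:|\theta|=1\}$. A Banach space $X$ has the super alternative Daugavet property (super ADP) if for every $x\in S_X$ and every non-empty relatively weakly open subset $W$ of $B_X$ with $W\cap S_X\neq\emptyset$, one has $\sup_{y\in W}\max_{\theta\in\mathbb{T}}\|x+\theta y\|=2$. A Banach space $X$ has the Kadec property if the identity map $(B_X,\text{weak})\to(B_X,\|\cdot\|)$ is continuous at every point of $S_X$. *)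

(* Defs.v *)
From HB Require Import structures.
From mathcomp Require Import all_boot all_order all_algebra.
From mathcomp Require Import complex.
From mathcomp Require Import all_classical all_reals all_analysis.
From mathcomp Require Import lra.

Set Implicit Arguments.
Unset Strict Implicit.
Unset Printing Implicit Defensive.

Import Order.TTheory GRing.Theory Num.Theory.
Import numFieldNormedType.Exports.

Local Open Scope classical_set_scope.
Local Open Scope ring_scope.

Variant scalar_kind := RealScalars | ComplexScalars.

Definition scalar_field (R : realType) (k : scalar_kind) : numFieldType :=
  match k with
  | RealScalars => R
  | ComplexScalars => R[i]
  end.

Lemma complex_complete (R : realType)
    (F : set_system ((R[i] : numFieldType)^o)) :
  ProperFilter F -> cauchy F -> cvg F.
Proof.
move=> FF /cauchy_ballP Fc.
have normRe (z : R[i]) : `|z| = (Normc.normc z)%:C%C by [].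
have le_part (z : R[i]) (e : R) : `|z| < e%:C%C ->
    `|complex.Re z| < e /\ `|complex.Im z| < e.
  rewrite normRe ltcR => h; split; apply: le_lt_trans h.
    by case: z => a b /=; rewrite -sqrtr_sqr ler_wsqrtr// lerDl sqr_ge0.
  by case: z => a b /=; rewrite -sqrtr_sqr ler_wsqrtr// lerDr sqr_ge0.
have part (p : R[i] -> R) :
    (forall (z : R[i]) (e : R), `|z| < e%:C%C -> `|p z| < e) ->
    (forall z w, p (z - w) = p z - p w) ->
    cvg (p @ (F : set_system R[i])).
  move=> pe pB; apply: R_complete.
  apply/cauchy_ballP => e e0.
  have eC : 0 < e%:C%C :> R[i] by rewrite ltcR.
  have [[A B]/= [FA FB] AB] := Fc _ eC.
  exists (p @` A, p @` B).
    split; rewrite /fmap /=; [apply: filterS FA|apply: filterS FB] => z Az;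
      by exists z.
  move=> [_ _] /= [[a Aa <-] [b Bb <-]].
  have := AB (a, b) (conj Aa Bb).
  rewrite /= -ball_normE /= => h.
  by rewrite /ball /= -pB; exact: pe.
have /cvg_ex[/= a Fa] : cvg ((@complex.Re R : R[i] -> R) @ (F : set_system R[i])).
  apply: part; first by move=> z e /le_part[].
  by move=> [? ?] [? ?].
have /cvg_ex[/= b Fb] : cvg ((@complex.Im R : R[i] -> R) @ (F : set_system R[i])).
  apply: part; first by move=> z e /le_part[].
  by move=> [? ?] [? ?].
apply/cvg_ex; exists (a +i* b)%C.
apply/cvgrPdist_lt => /= e e0.
have [e' e'E e'0] : exists2 e' : R, e = e'%:C%C & 0 < e'.
  case: e e0 => x y; rewrite ltcE /= => /andP[/eqP y0 x0]; exists x => //.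
  by move: y0 => ->.
have e2 : 0 < e' / 2 by rewrite divr_gt0.
move/cvgrPdist_lt : Fa => /(_ _ e2) Fa.
move/cvgrPdist_lt : Fb => /(_ _ e2) Fb.
have {}Fa : F [set z | `|a - complex.Re z| < e' / 2] := Fa.
have {}Fb : F [set z | `|b - complex.Im z| < e' / 2] := Fb.
apply: filterS (filterI Fa Fb) => -[c d] /= [ca db].
rewrite e'E normRe ltcR /=.
rewrite -(@ltr_pXn2r _ 2%N)// ?nnegrE ?sqrtr_ge0 ?ltW//.
rewrite sqr_sqrtr ?addr_ge0 ?sqr_ge0//.
rewrite -(real_normK (num_real (a - c))) -(real_normK (num_real (b - d))).
have h1 := normr_ge0 (a - c); have h2 := normr_ge0 (b - d).
nra.
Qed.

Lemma scalar_field_complete (R : realType) (k : scalar_kind)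
    (F : set_system (scalar_field R k)^o) :
  ProperFilter F -> cauchy F -> cvg F.
Proof.
case: k F => F FF Fc; first exact: (@R_complete R F FF Fc).
exact: complex_complete.
Qed.

Definition scalar_space (R : realType) (k : scalar_kind) :
    completeNormedModType (scalar_field R k) :=
  HB.pack ((scalar_field R k)^o)
    (Uniform_isComplete.Build ((scalar_field R k)^o) (@scalar_field_complete R k)).

(* Norms of a [normedModType K] take their values in [K]. When [K] is [R[i]]
   these are nonnegative reals, and the order of [R[i]] only compares numbers
   with equal imaginary parts, so maxima and least upper bounds of nonempty
   sets of norms, taken in [K], are those taken in [R]. *)
Definition unit_ball {K : numFieldType} (X : normedModType K) : set X := [set x | `|x| <= 1].
Arguments unit_ball {K} X _.

Definition unit_sphere {K : numFieldType} (X : normedModType K) : set X := [set x | `|x| = 1].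
Arguments unit_sphere {K} X _.

Definition unimodular {K : numFieldType} : set K := [set t | `|t| = 1].

Definition nonzero_space {K : numFieldType} (X : normedModType K) : Prop :=
  exists x : X, x != 0.

Definition finite_dimensional {K : numFieldType} (X : normedModType K) : Prop :=
  exists (n : nat) (e : 'I_n -> X), forall x : X,
    exists c : 'I_n -> K, x = \sum_(i < n) c i *: e i.

Definition isometrically_isomorphic {K : numFieldType} (X Y : normedModType K) : Prop :=
  exists f : {linear X -> Y}, bijective f /\ forall x : X, `|f x| = `|x|.

Definition dual {K : numFieldType} (X : normedModType K) : Type :=
  {f : {linear X -> K^o} | continuous f}.

(* The coarsest topology making every continuous linear functional continuous. *)
Definition weak {K : numFieldType} (X : normedModType K) : topologicalType :=
  sup_topology (fun f : dual X =>
    Topological.on (initial_topology (sval f : X -> K^o))).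

Definition relatively_weakly_open {K : numFieldType} (X : normedModType K) (A W : set X) : Prop :=
  exists2 U : set (weak X), open U & W = A `&` U.

Definition is_max {K : numFieldType} (A : set K) (m : K) : Prop := A m /\ ubound A m.

Definition super_ADP {K : numFieldType} (X : normedModType K) : Prop :=
  forall (x : X) (W : set X),
    unit_sphere X x ->
    relatively_weakly_open (unit_ball X) W ->
    W !=set0 ->
    W `&` unit_sphere X !=set0 ->
    isLub [set m | exists2 y, W y &
             is_max [set `|x + t *: y| | t in unimodular] m] 2.

(* The source carries the subspace topology of the weak topology, the target
   that of the norm topology; the two print alike without implicit arguments. *)
Definition Kadec {K : numFieldType} (X : normedModType K) : Prop :=
  forall x : X, unit_sphere X x ->
    {for x, continuous (id : @subspace (weak X) (unit_ball X) ->
                             @subspace X (unit_ball X))}.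

(* Main.v *)
Require Import Defs.
From HB Require Import structures.
From mathcomp Require Import all_boot all_order all_algebra.
From mathcomp Require Import complex.
From mathcomp Require Import all_classical all_reals all_analysis.
From mathcomp Require Import ring.

(* In a super ADP space with the Kadec property, relatively weakly open
   neighbourhoods of a point y of the sphere can be taken norm-small, so for all
   unit x and y the supremum over unimodular t of |x + t y| is 2. Suppose u and
   v are linearly independent. On the Euclidean sphere of K^2, the norm of
   a u + b v is maximal at some x = a u + b v; let y be the image of the unit
   vector orthogonal to (a, b). Then |x + t y| <= |x| sqrt (1 + |t|^2) for all
   scalars t, so moving away from x in any direction t y changes the norm only to
   second order; hence the supremum for x / |x| and y / |y| is less than 2, a
   contradiction. In finite dimension the weak and norm topologies coincide,
   whence the Kadec property. *)

Set Implicit Arguments.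
Unset Strict Implicit.
Unset Printing Implicit Defensive.

Import Order.TTheory GRing.Theory Num.Theory.
Import numFieldNormedType.Exports.

Local Open Scope classical_set_scope.
Local Open Scope ring_scope.

(** * Real and complex scalars treated uniformly *)

Section Scalars.
Context {R : realType}.

(** Norms take values in [K], while the extreme value theorem and closedness of half-lines are
    applied in [R]. On norms, which are nonnegative reals, taking the real part loses nothing. *)
Definition scalar_re (k : scalar_kind) : scalar_field R k -> R :=
  match k with RealScalars => id | ComplexScalars => @complex.Re R end.

Lemma normc_ge_Im (z : R[i]) : `|complex.Im z|%:C%C <= `|z|.
Proof. by case: z => a b; rewrite lecR -sqrtr_sqr ler_wsqrtr// lerDr sqr_ge0. Qed.

Lemma Re_continuous : continuous (@complex.Re R : R[i]^o -> R).
Proof.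
move=> z A /nbhs_ballP[/= e e0 sA].
apply/(@nbhs_ballP _ R[i]^o); exists e%:C%C => /=; first by rewrite ltcR.
move=> w; rewrite -ball_normE /= => zw; apply: sA; rewrite -ball_normE /=.
rewrite -ltcR; apply: le_lt_trans zw.
by have := normc_ge_Re (z - w); case: (z) (w) => ? ? [? ?].
Qed.

Lemma complex_continuous :
  continuous (fun p : R * R => (p.1 +i* p.2)%C : R[i]^o).
Proof.
move=> [a b] A /(@nbhs_ballP _ R[i]^o)[/= [e e']].
rewrite ltcE /= => /andP[/eqP -> e0] sA.
apply/nbhs_ballP; exists (e / 2); first by rewrite /= divr_gt0.
move=> [c d] [] /=; rewrite -!ball_normE /= => ac bd; apply: sA.
rewrite -ball_normE /=.
rewrite [X in `|X|](_ : _ = (a - c)%:C%C + 'i%C * (b - d)%:C%C); last by simpc.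
apply: le_lt_trans (ler_normD _ _) _.
by rewrite normrM !normc_def /= !expr0n !expr1n !(addr0, add0r) ?sqrtr1 !sqrtr_sqr
  mul1r -rmorphD ltcR [ltRHS]splitr ltrD.
Qed.

Lemma scalar_re_continuous (k : scalar_kind) :
  continuous (scalar_re (k := k) : (scalar_field R k)^o -> R).
Proof. by case: k; [move=> z; exact: cvg_id | exact: Re_continuous]. Qed.

Lemma scalar_norm_continuous (k : scalar_kind)
    (X : normedModType (scalar_field R k)) :
  continuous (fun x : X => scalar_re `|x|).
Proof.
move=> x; apply: continuous_comp; first exact: norm_continuous.
exact: scalar_re_continuous.
Qed.

Lemma scalar_re_le (k : scalar_kind) (a b : scalar_field R k) :
  0 <= a -> 0 <= b -> scalar_re a <= scalar_re b -> a <= b.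
Proof.
case: k a b => //= -[a a'] [b b'] /=.
by rewrite !lecE /= => /andP[/eqP -> _] /andP[/eqP -> _] ->; rewrite eqxx.
Qed.

Lemma scalar_re_homo (k : scalar_kind) (a b : scalar_field R k) :
  a <= b -> scalar_re a <= scalar_re b.
Proof. by case: k a b => //= -[a a'] [b b'] /andP[]. Qed.

Lemma scalar_sqrt (k : scalar_kind) (a : scalar_field R k) :
  0 <= a -> exists2 r, 0 <= r & r ^+ 2 = a.
Proof.
case: k a => /= a a0.
  by exists (Num.sqrt a); rewrite ?sqrtr_ge0 ?sqr_sqrtr.
by exists (sqrtC a); rewrite ?sqrtC_ge0 ?sqrtCK.
Qed.

Lemma closed_rotation (C : numClosedFieldType) (a b : C) :
  exists c d : C, [/\ a * d - b * c = `|a| ^+ 2 + `|b| ^+ 2,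
    `|c| ^+ 2 + `|d| ^+ 2 = `|a| ^+ 2 + `|b| ^+ 2 &
    forall t, `|a + t * c| ^+ 2 + `|b + t * d| ^+ 2 =
      (1 + `|t| ^+ 2) * (`|a| ^+ 2 + `|b| ^+ 2)].
Proof.
exists (- b^*), a^*; split=> [||t];
  rewrite !normCK ?(rmorphD, rmorphM, rmorphN) /= ?conjCK; ring.
Qed.

Lemma scalar_rotation (k : scalar_kind) (a b : scalar_field R k) :
  exists c d : scalar_field R k, [/\ a * d - b * c = `|a| ^+ 2 + `|b| ^+ 2,
    `|c| ^+ 2 + `|d| ^+ 2 = `|a| ^+ 2 + `|b| ^+ 2 &
    forall t, `|a + t * c| ^+ 2 + `|b + t * d| ^+ 2 =
      (1 + `|t| ^+ 2) * (`|a| ^+ 2 + `|b| ^+ 2)].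
Proof.
case: k a b => /= a b; last exact: closed_rotation.
by exists (- b), a; split=> [||t]; rewrite !real_normK ?num_real//; ring.
Qed.

(** The disc is a closed subset of a continuous image [g] of the compact square [[-r, r]^2]; for
    real scalars the second coordinate is discarded. *)
Lemma scalar_disc_compact (k : scalar_kind) (r : R) :
  compact [set z : (scalar_field R k)^o | scalar_re `|z| <= r].
Proof.
have dE : closed [set z : (scalar_field R k)^o | scalar_re `|z| <= r].
  apply: (@preimage_closed _ _ (fun z : (scalar_field R k)^o => scalar_re `|z|)
    [set x | x <= r]); last exact: closed_le.
  by move=> z _; exact: scalar_norm_continuous.
pose g : R * R -> (scalar_field R k)^o :=
  match k return R * R -> (scalar_field R k)^o with
  | RealScalars => fst
  | ComplexScalars => fun p => (p.1 +i* p.2)%C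
  end.
apply: (@subclosed_compact _ _ (g @` (`[- r, r] `*` `[- r, r]))) => //.
- apply: continuous_compact; last by apply: compact_setX; exact: segment_compact.
  apply: continuous_subspaceT; rewrite /g; case: {dE g} k.
    by move=> ?; exact: cvg_fst.
  exact: complex_continuous.
- rewrite {}/g; case: {dE} k => z /= zr.
    exists (z, 0) => //=.
    by rewrite !in_itv /= -!ler_norml normr0 zr (le_trans _ zr).
  exists (complex.Re z, complex.Im z) => /=; last by case: (z).
  rewrite !in_itv /= -!ler_norml -!lecR.
  have rz : `|z| = (complex.Re `|z|)%:C%C by case: (z).
  have {}zr : `|z| <= r%:C%C by rewrite rz lecR.
  by split; apply: le_trans zr; [exact: normc_ge_Re|exact: normc_ge_Im].
Qed.

End Scalars.

(** * Extrema of norms on compact sets, and bases in finite dimension *)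

Section Compactness.
Context {R : realType} {k : scalar_kind}.
Local Notation K := (scalar_field R k).

Lemma compact_norm_max (X : normedModType K) (T : topologicalType)
    (A : set T) (f : T -> X) :
  A !=set0 -> compact A -> continuous f ->
  exists2 c, A c & forall t, A t -> `|f t| <= `|f c|.
Proof.
move=> A0 cA cf.
have [|c] := @compact_EVT_max T R (fun t => scalar_re `|f t|) A A0 cA.
  apply: continuous_subspaceT => t.
  apply: (@continuous_comp _ _ _ f (fun x => scalar_re `|x|)); first exact: cf.
  exact: scalar_norm_continuous.
rewrite inE => Ac cmax; exists c => // t At.
by apply: scalar_re_le => //; apply: cmax; rewrite inE.
Qed.

Lemma compact_norm_min (X : normedModType K) (T : topologicalType)
    (A : set T) (f : T -> X) :
  A !=set0 -> compact A -> continuous f ->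
  exists2 c, A c & forall t, A t -> `|f c| <= `|f t|.
Proof.
move=> A0 cA cf.
have [|c] := @compact_EVT_min T R (fun t => scalar_re `|f t|) A A0 cA.
  apply: continuous_subspaceT => t.
  apply: (@continuous_comp _ _ _ f (fun x => scalar_re `|x|)); first exact: cf.
  exact: scalar_norm_continuous.
rewrite inE => Ac cmin; exists c => // t At.
by apply: scalar_re_le => //; apply: cmin; rewrite inE.
Qed.

Lemma mx_norm_ge_coord n (v : 'rV[K]_n) i : `|v ord0 i| <= `|v|.
Proof.
rewrite [leRHS]/Num.norm /= mx_normE.
exact: (@le_bigmax _ _ _ 0%:nng (fun i => `|v i.1 i.2|%:nng) (ord0, i)).
Qed.

Lemma rV_sphere_compact n : compact [set v : 'rV[K]_n | `|v| = 1].
Proof.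
have bc := @rV_compact K^o n
  (fun=> [set z : K^o | scalar_re `|z| <= scalar_re (1 : K)])
  (fun=> @scalar_disc_compact R k _).
apply: subclosed_compact bc _.
  apply: (@preimage_closed _ K^o (fun v : 'rV[K]_n => `|v|) [set 1]).
    by move=> v _; exact: norm_continuous.
  exact/accessible_closed_set1/hausdorff_accessible/norm_hausdorff.
move=> v /= v1 i; apply: scalar_re_homo.
by have := mx_norm_ge_coord v i; rewrite v1.
Qed.

Lemma lincomb_continuous (X : normedModType K) (T : topologicalType) n
    (g : 'I_n -> T -> K) (e : 'I_n -> X) :
  (forall i, continuous (g i)) -> continuous (fun t => \sum_(i < n) g i t *: e i).
Proof.
move=> cg; elim: (index_enum _) => [|i s cs] t.
  rewrite (_ : (fun _ => _) = cst 0); first exact: cst_continuous.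
  by apply/funext => w; rewrite big_nil.
rewrite (_ : (fun _ => _) =
    (fun t => g i t *: e i + \sum_(j <- s) g j t *: e j)).
  apply: (cvgD _ (cs t)); apply: cvgZ; last exact: cst_continuous.
  exact: cg.
by apply/funext => w; rewrite big_cons.
Qed.

(** The constant [m] is the minimum of the norm of [S v] over the compact sphere of [K^n]. Freeness
    makes it positive, and homogeneity carries the bound to all coordinate vectors. *)
Lemma free_coord_bound (X : normedModType K) n (e : 'I_n -> X) :
    (forall c : 'I_n -> K, \sum_(i < n) c i *: e i = 0 -> forall i, c i = 0) ->
  exists2 m : K, 0 < m & forall (c : 'I_n -> K) i,
    m * `|c i| <= `|\sum_(i < n) c i *: e i|.
Proof.
(* For [n = 0] the sphere is empty and has no minimiser, but then the bound is vacuous. *)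
case: n e => [e _|n e free_e]; first by exists 1 => // c [].
pose S (v : 'rV[K]_n.+1) := \sum_i v ord0 i *: e i.
have [|v v1 vmin] := @compact_norm_min X _ [set v : 'rV[K]_n.+1 | `|v| = 1] S _
  (@rV_sphere_compact _)
  (@lincomb_continuous X _ _ (fun i (v : 'rV[K]_n.+1) => v ord0 i) e
    (fun=> @coord_continuous _ _ _ _ _)).
  pose w : 'rV[K]_n.+1 := const_mx 1.
  have w0 : w != 0.
    by apply/eqP => /matrixP/(_ ord0 ord0)/eqP; rewrite !mxE oner_eq0.
  by exists (`|w|^-1 *: w); rewrite /= normrZ normfV normr_id mulVf ?normr_eq0.
exists `|S v|.
  rewrite normr_gt0; apply/eqP => /free_e Sv0.
  have : `|v| = 0.
    by rewrite (_ : v = 0) ?normr0//; apply/rowP => i; rewrite Sv0 mxE.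
  by rewrite v1 => /eqP; rewrite oner_eq0.
move=> c i; pose w := \row_i c i.
have Sw : S w = \sum_i c i *: e i by apply: eq_bigr => j _; rewrite mxE.
have cw : `|c i| <= `|w| by have := mx_norm_ge_coord w i; rewrite mxE.
apply: (@le_trans _ _ (`|S v| * `|w|)); first by rewrite ler_wpM2l.
have [->|w0] := eqVneq w 0; first by rewrite normr0 mulr0.
rewrite -Sw -ler_pdivlMr ?normr_gt0//.
have -> : `|S w| / `|w| = `|S (`|w|^-1 *: w)|.
  rewrite mulrC -[X in X^-1 * _]normr_id -normfV -normrZ scaler_sumr /S.
  congr `|_|.
  by apply: eq_bigr => j _; rewrite scalerA [in RHS]mxE.
by apply: vmin; rewrite /= normrZ normfV normr_id mulVf ?normr_eq0.
Qed.

End Compactness.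

(** A spanning family of minimal size is free: a nontrivial relation would allow one vector to be
    dropped. *)
Lemma finite_dimensional_free {K : numFieldType} (X : normedModType K) :
  finite_dimensional X -> exists (n : nat) (e : 'I_n -> X),
    (forall x, exists c : 'I_n -> K, x = \sum_(i < n) c i *: e i) /\
    (forall c : 'I_n -> K, \sum_(i < n) c i *: e i = 0 -> forall i, c i = 0).
Proof.
move=> fX.
pose P n := `[< exists e : 'I_n -> X,
  forall x, exists c : 'I_n -> K, x = \sum_(i < n) c i *: e i >].
have exP : exists n, P n.
  by case: fX => n [e eX]; exists n; apply/asboolP; exists e.
case: (ex_minnP exP) => n /asboolP[e eX] nmin; exists n, e; split=> // c c0 i.
apply/eqP/negP => /negP ci0.
case: n => [|n] in e eX nmin c c0 i ci0 *; first by case: i ci0.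
suff /nmin : P n by rewrite ltnn.
apply/asboolP; exists (fun j => e (lift i j)) => x; have [d ->] := eX x.
(* These coefficients arise by solving the relation for [e i] and substituting it in the expansion
   of [x]. *)
exists (fun j => d (lift i j) - d i / c i * c (lift i j)).
have ei : e i = - (c i)^-1 *: \sum_(j < n) c (lift i j) *: e (lift i j).
  move: c0; rewrite (bigD1_ord i)//= => /eqP; rewrite addr_eq0 => /eqP eci.
  apply: (scalerI ci0); rewrite eci scalerA mulrN mulfV// scaleN1r.
  by congr (- _); apply: eq_bigr => j _.
rewrite (bigD1_ord i)//= ei scalerA scaler_sumr -big_split/=.
by apply: eq_bigr => j _; rewrite scalerA -scalerDl; congr (_ *: _); ring.
Qed.

(** * Weak topology and the Kadec property *)

Lemma dual_weak_continuous {K : numFieldType} (X : normedModType K) (f : dual X) :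
  continuous (sval f : weak X -> K^o).
Proof.
move=> x.
have /cvg_sup/(_ f) xf : nbhs (x : weak X) --> (x : weak X) by exact: cvg_id.
by move=> A /(@initial_continuous X K^o (sval f) x)/xf.
Qed.

(** Turns continuity between two subspace topologies into the existence of norm-small sets [W] of
    the kind that [super_ADP] quantifies over. *)
Lemma Kadec_weak_nbhs {K : numFieldType} (X : normedModType K) :
  Kadec X <-> forall (x : X) (e : K), unit_sphere X x -> 0 < e ->
    exists2 W, relatively_weakly_open (unit_ball X) W & W x /\ W `<=` ball x e.
Proof.
split=> [kX x e x1 e0|h x x1].
  have Bx : unit_ball X x by rewrite /unit_ball /= x1.
  have xe : @nbhs_subspace X (unit_ball X) x (ball x e).
    by rewrite -nbhs_subspace_in//; apply: filterS (nbhsx_ballx x e e0).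
  have : @nbhs_subspace (weak X) (unit_ball X) x (ball x e) := kX x x1 _ xe.
  rewrite -nbhs_subspace_in// /within/= nbhsE => -[U [oU Ux] sU].
  exists (unit_ball X `&` U); first by exists U.
  by split=> // y [By Uy]; exact: (sU y Uy By).
have Bx : unit_ball X x by rewrite /unit_ball /= x1.
move=> A xA; change (@nbhs_subspace (weak X) (unit_ball X) x A).
have {xA} : @nbhs_subspace X (unit_ball X) x A := xA.
rewrite -!nbhs_subspace_in// => /nbhs_ballP[e /= e0 sA].
have [W [U oU ->] [[_ Ux] sW]] := h x e x1 e0.
rewrite /within/= nbhsE; exists U; first by split.
by move=> y Uy By; apply: sA => //; apply: sW.
Qed.

Section FiniteDimension.
Context {R : realType} {k : scalar_kind}.
Local Notation K := (scalar_field R k).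

(** The identity is a finite sum of coordinate functionals times basis vectors. The functionals are
    norm continuous by [free_coord_bound], hence weakly continuous. *)
Lemma finite_dimensional_weak (X : normedModType K) :
  finite_dimensional X -> continuous (id : weak X -> X).
Proof.
move=> /finite_dimensional_free[n [e [/choice[c cE] free_e]]].
have [m m0 cm] := free_coord_bound free_e.
(* Uniqueness of coordinates is what makes the arbitrarily chosen [c] linear. *)
have cU d d' : \sum_(i < n) d i *: e i = \sum_(i < n) d' i *: e i -> d = d'.
  move=> dd'; apply/funext => i; apply/eqP; rewrite -subr_eq0; apply/eqP.
  apply: (free_e (fun i => d i - d' i)).
  by under eq_bigr do rewrite scalerBl; rewrite sumrB dd' subrr.
have clin i : linear (fun x => c x i : K^o).
  move=> a x y; suff -> : c (a *: x + y) = (fun i => a * c x i + c y i) by [].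
  apply: cU; rewrite -cE; under eq_bigr do rewrite scalerDl -scalerA.
  by rewrite big_split/= -scaler_sumr -!cE.
pose f i : {linear X -> K^o} := HB.pack (fun x => c x i : K^o)
  (GRing.isLinear.Build K X K^o *:%R (fun x => c x i : K^o) (clin i)).
have fc i : continuous (f i).
  move=> x; apply/cvgrPdist_lt => /= d d0.
  apply/nbhs_ballP; exists (m * d); first by rewrite /= mulr_gt0.
  move=> y; rewrite -ball_normE /= => xy.
  rewrite -[_ - _]/(f i x - f i y) -raddfB /= -(ltr_pM2l m0).
  by apply: le_lt_trans xy; rewrite [in leRHS](cE (x - y)) cm.
rewrite (_ : id = (fun x : weak X => \sum_(i < n) f i x *: e i)).
  apply: lincomb_continuous => i.
  exact: (@dual_weak_continuous _ X (exist _ (f i) (fc i))).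
by apply/funext => x; rewrite -cE.
Qed.

Lemma finite_dimensional_Kadec (X : normedModType K) :
  finite_dimensional X -> Kadec X.
Proof.
move=> /finite_dimensional_weak wX; apply/Kadec_weak_nbhs => x e x1 e0.
have [U [oU Ux] sU] := wX x _ (nbhsx_ballx (x : X) e e0).
exists (unit_ball X `&` U); first by exists U.
by split; [split=> //; rewrite /unit_ball /= x1|move=> y [_ /sU]].
Qed.

End FiniteDimension.

Lemma super_ADP_Kadec_sphere {K : numFieldType} (X : normedModType K)
    (x y : X) (d : K) :
  super_ADP X -> Kadec X -> `|x| = 1 -> `|y| = 1 -> 0 < d ->
  exists2 t : K, `|t| = 1 & 2 - d < `|x + t *: y|.
Proof.
move=> aX /Kadec_weak_nbhs kX x1 y1 d0.
have d2 : 0 < d / 2 by rewrite divr_gt0.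
(* Replacing a point of [W] by [y] changes the norm by at most [d / 2]. So if every unimodular [t]
   gave at most [2 - d] at [y], then [2 - d / 2] would bound the set whose supremum is 2. *)
have [W oW [Wy sW]] := kX y _ y1 d2.
have [||_ lub2] := aX x W x1 oW; [by exists y|by exists y|].
apply: contrapT => nt.
have /lub2 : ubound [set m | exists2 y, W y &
    is_max [set `|x + t *: y| | t in unimodular] m] (2 - d / 2).
  move=> m [z Wz [[t t1 <-] _]].
  have tz : `|x + t *: z| <= `|x + t *: y| + `|y - z|.
    rewrite (_ : x + t *: z = (x + t *: y) - t *: (y - z)).
      by rewrite (le_trans (ler_normB _ _))// normrZ t1 mul1r.
    by rewrite scalerBr opprB [t *: z - _]addrC addrA addrK.
  have yz : `|y - z| <= d / 2 by apply: ltW; have := sW z Wz; rewrite -ball_normE.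
  apply: (le_trans tz); rewrite (_ : 2 - d / 2 = (2 - d) + d / 2); last by field.
  apply: lerD => //; rewrite real_leNgt; last 2 first.
  - exact: ger0_real.
  - by rewrite realB// gtr0_real// ltr0n.
  by apply/negP => h; apply: nt; exists t.
by rewrite lerDl oppr_ge0 => /(lt_le_trans d2); rewrite ltxx.
Qed.

Lemma alternative_not_euclidean {K : numFieldType} (X : normedModType K)
    (x y : X) :
  x != 0 -> y != 0 -> `|y| <= `|x| ->
  (forall t : K, `|x + t *: y| ^+ 2 <= `|x| ^+ 2 * (1 + `|t| ^+ 2)) ->
  (forall d : K, 0 < d -> exists2 t : K, `|t| = 1 &
     2 - d < `| `|x|^-1 *: x + t *: (`|y|^-1 *: y)|) -> False.
Proof.
rewrite -!normr_gt0 => x0 y0 yx euc alt.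
(* Moving s * t * y / |y| away from x / |x|, with s the square of |y| / |x|, gives
   norm > 1 + s / 2 by convexity but at most sqrt (1 + s) by [euc]. *)
pose q := `|y| / `|x|; pose s := q ^+ 2.
have q0 : 0 < q by rewrite divr_gt0.
have s0 : 0 < s by rewrite exprn_gt0.
have s1 : s <= 1 by rewrite expr_le1 ?(ltW q0)// /q ler_pdivrMr// mul1r.
have s2 : 0 < s / 2 by rewrite divr_gt0.
have [t t1] := alt _ s2.
set x' := _ *: x; set y' := _ *: y => xy.
have y'1 : `|y'| = 1 by rewrite normrZ normfV normr_id mulVf ?gt_eqF.
have lower : 1 + s / 2 < `|x' + (s * t) *: y'|.
  have -> : 1 + s / 2 = 2 - s / 2 - (1 - s) by field.
  rewrite ltrBlDr; apply: lt_le_trans xy _.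
  rewrite (_ : x' + t *: y' = x' + (s * t) *: y' + ((1 - s) * t) *: y').
    apply: le_trans (ler_normD _ _) _.
    by rewrite lerD2l normrZ normrM t1 y'1 !mulr1 ger0_norm ?subr_ge0.
  by rewrite -addrA -scalerDl; congr (_ + _ *: _); ring.
have upper : `|x' + (s * t) *: y'| ^+ 2 <= 1 + s.
  (* Since [s = q ^+ 2], one has [s / |y| = q / |x|]; factoring out [1 / |x|] allows [euc] at
     [q * t], where [|q * t| ^+ 2 = s]. *)
  have -> : x' + (s * t) *: y' = `|x|^-1 *: (x + (q * t) *: y).
    rewrite scalerDr !scalerA; congr (_ + _ *: _).
    by rewrite /s /q; field; rewrite !gt_eqF.
  rewrite normrZ normfV normr_id exprMn exprVn ler_pdivrMl ?exprn_gt0//.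
  by apply: le_trans (euc _) _; rewrite normrM t1 mulr1 (gtr0_norm q0).
have : (1 + s / 2) ^+ 2 < 1 + s.
  apply: lt_le_trans upper; rewrite ltr_pXn2r// nnegrE ?normr_ge0//.
  by rewrite addr_ge0 ?divr_ge0// ltW.
have -> : (1 + s / 2) ^+ 2 = 1 + s + (s / 2) ^+ 2 by field.
by rewrite gtrDl => /(lt_trans (exprn_gt0 2 s2)); rewrite ltxx.
Qed.

(** * Reduction to dimension one, and the scalar space itself *)

Section OneDimensional.
Context {R : realType} {k : scalar_kind}.
Local Notation K := (scalar_field R k).

Lemma super_ADP_Kadec_dependent (X : normedModType K) (u v : X) :
  super_ADP X -> Kadec X -> exists a b : K,
    (a, b) != (0, 0) /\ a *: u + b *: v = 0.
Proof.
move=> aX kX; apply: contrapT => /forallNP nuv.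
have free a b : a *: u + b *: v = 0 -> a = 0 /\ b = 0.
  move=> ab0; have /forallNP/(_ b)/not_andP[/negP|//] := nuv a.
  by rewrite negbK => /eqP[-> ->].
(* The Euclidean norm is written out, squared, because the norm of a product space is the maximum
   norm. *)
pose N (p : K^o * K^o) : K := `|p.1| ^+ 2 + `|p.2| ^+ 2.
pose f (p : K^o * K^o) : X := p.1 *: u + p.2 *: v.
have fstc : continuous (fst : K^o * K^o -> K^o) by move=> p; exact: cvg_fst.
have sndc : continuous (snd : K^o * K^o -> K^o) by move=> p; exact: cvg_snd.
have Nc : continuous (N : K^o * K^o -> K^o).
  have nc (g : K^o * K^o -> K^o) : continuous g ->
      continuous ((fun p => `|g p| ^+ 2) : K^o * K^o -> K^o).
    move=> gc p; rewrite /GRing.exp /=.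
    have ng : {for p, continuous (fun p => `|g p| : K^o)}.
      by apply: (continuous_comp (gc p)); exact: norm_continuous.
    exact: (cvgM ng ng).
  by move=> p; exact: (cvgD (nc _ fstc p) (nc _ sndc p)).
have fc : continuous f.
  move=> p; apply: cvgD.
    by apply: cvgZ; [exact: fstc|exact: cst_continuous].
  by apply: cvgZ; [exact: sndc|exact: cst_continuous].
have N1c : compact [set p | N p = 1].
  apply: subclosed_compact (compact_setX
    (@scalar_disc_compact R k (scalar_re (1 : K)))
    (@scalar_disc_compact R k (scalar_re (1 : K)))) _.
    apply: (@preimage_closed _ _ N [set 1]) => [p _|]; first exact: Nc.
    exact/accessible_closed_set1/hausdorff_accessible/norm_hausdorff.
  have le1 (a b : K) : `|a| ^+ 2 + `|b| ^+ 2 = 1 ->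
      scalar_re `|a| <= scalar_re (1 : K).
    move=> ab1; apply: scalar_re_homo; rewrite -(@expr_le1 _ 2)//.
    by rewrite -ab1 lerDl exprn_ge0.
  move=> [a b] /= ab1; split => /=; first exact: le1 ab1.
  by apply: (le1 b a); rewrite addrC.
have [|[a b] /= ab1 abmax] :=
  @compact_norm_max R k X _ [set p | N p = 1] f _ N1c fc.
  by exists (1, 0); rewrite /= /N /= normr1 normr0 expr1n expr0n addr0.
(* The maximum over [N p = 1] extends to all [p] by homogeneity, scaling by the square root [r] of
   [N p]. *)
have fmax p : `|f p| ^+ 2 <= `|f (a, b)| ^+ 2 * N p.
  have Np0 : 0 <= N p by rewrite addr_ge0// exprn_ge0.
  have [r r0 rN] := scalar_sqrt Np0.
  have [r_eq0|r_neq0] := eqVneq r 0.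
    move: rN; rewrite r_eq0 expr0n /= => /esym/eqP.
    rewrite paddr_eq0 ?exprn_ge0// !expf_eq0 /= !normr_eq0.
    move=> /andP[/eqP p1 /eqP p2].
    rewrite /f p1 p2 !scale0r addr0 normr0 expr0n /=.
    by rewrite mulr_ge0// exprn_ge0.
  rewrite -rN -exprMn ler_pXn2r ?nnegrE ?mulr_ge0//.
  have r_gt0 : 0 < r by rewrite lt_def r_neq0.
  rewrite -ler_pdivrMr// (_ : _ / r = `|f (r^-1 * p.1, r^-1 * p.2)|).
    apply: abmax; rewrite /N /= !normrM !exprMn -mulrDr normfV (gtr0_norm r_gt0).
    by rewrite exprVn rN -/(N p) mulVf// -rN expf_neq0.
  by rewrite /f /= -!scalerA -scalerDr normrZ normfV (gtr0_norm r_gt0) mulrC.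
(* The determinant being 1 keeps [(c, d)] nonzero, [cd1] puts it in the domain of [abmax], and [rot]
   with [fmax] gives the second-order bound along [f (c, d)]. *)
have [c [d [adbc cd1 rot]]] := scalar_rotation a b.
have {}ab1 : `|a| ^+ 2 + `|b| ^+ 2 = 1 := ab1.
rewrite ab1 in adbc cd1 rot.
have f_neq0 p : p != (0, 0) -> f p != 0.
  by move=> p0; apply: contra p0 => /eqP/free[]; case: p => ? ? /= -> ->.
have x0 : f (a, b) != 0.
  apply: f_neq0; apply/eqP => -[a0 b0]; move/eqP: ab1.
  by rewrite a0 b0 normr0 expr0n addr0 eq_sym oner_eq0.
have y0 : f (c, d) != 0.
  apply: f_neq0; apply/eqP => -[c0 d0]; move/eqP: adbc.
  by rewrite c0 d0 !mulr0 subr0 eq_sym oner_eq0.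
apply: (alternative_not_euclidean x0 y0) => [||e e0].
- exact: abmax.
- move=> t; have := fmax (a + t * c, b + t * d); rewrite /N /= rot mulr1.
  by rewrite /f /= !scalerDr !scalerDl -!scalerA addrACA.
- by apply: super_ADP_Kadec_sphere => //;
    rewrite normrZ normfV normr_id mulVf ?normr_eq0.
Qed.

(** Every vector is dependent on a fixed unit vector [u], hence a multiple of it; the coefficient is
    the isometry because [u] has norm 1. *)
Lemma super_ADP_Kadec_scalar (X : normedModType K) :
  nonzero_space X -> super_ADP X -> Kadec X ->
  isometrically_isomorphic X (scalar_space R k).
Proof.
move=> [x x0] aX kX.
pose u := `|x|^-1 *: x.
have u1 : `|u| = 1 by rewrite normrZ normfV normr_id mulVf ?normr_eq0.
have u0 : u != 0 by rewrite -normr_eq0 u1 oner_eq0.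
have /choice[c cE] : forall y, exists c : K, y = c *: u.
  move=> y; have [a [b [ab0 abE]]] := super_ADP_Kadec_dependent y u aX kX.
  have [a0|a0] := eqVneq a 0.
    move: ab0 abE; rewrite a0 scale0r add0r => b0 /eqP.
    by rewrite scaler_eq0 (negbTE u0) orbF => /eqP bE; rewrite bE eqxx in b0.
  exists (- (a^-1 * b)); apply: (scalerI a0); rewrite scalerA mulrN mulVKf//.
  by rewrite scaleNr; apply/eqP; rewrite -addr_eq0 abE.
have cinj a b : a *: u = b *: u -> a = b.
  move/eqP; rewrite -subr_eq0 -scalerBl scaler_eq0 (negbTE u0) orbF subr_eq0.
  by move/eqP.
have clin : linear (c : X -> scalar_space R k).
  by move=> a y z; apply: cinj; rewrite -cE scalerDl -scalerA -!cE.
pose f : {linear X -> scalar_space R k} := HB.pack (c : X -> scalar_space R k)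
  (GRing.isLinear.Build K X (scalar_space R k) *:%R c clin).
exists f; split.
  exists (fun a : K => a *: u) => [y|a]; first by rewrite /= -cE.
  by apply: cinj; rewrite -cE.
by move=> y; rewrite [in RHS](cE y) normrZ u1 mulr1.
Qed.

Lemma scalar_space_finite_dimensional : finite_dimensional (scalar_space R k).
Proof.
exists 1, (fun=> 1 : K) => x; exists (fun=> x).
by rewrite big_ord1; exact: (esym (mulr1 x)).
Qed.

(** The supremum is attained at any [y] of [W] on the sphere: the unimodular scalar [x / y] rotates
    [y] onto [x], giving norm [|x + x| = 2]. *)
Lemma scalar_space_super_ADP : super_ADP (scalar_space R k).
Proof.
move=> x W x1 [U _ ->] _ [y [Wy y1]].
have bnd z : `|z| <= 1 -> forall t : K, `|t| = 1 -> `|x + t *: z| <= 2.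
  move=> z1 t t1; rewrite (le_trans (ler_normD _ _))// normrZ t1 mul1r x1.
  by rewrite -[leRHS]/(1 + 1) lerD2l.
split=> [m [z [z1 _] [[t t1 <-] _]]|m]; first exact: bnd.
apply; exists y => //; split; last by move=> _ [t t1 <-]; apply: bnd; case: Wy.
have {}x1 : `|x : K| = 1 := x1.
have {}y1 : `|y : K| = 1 := y1.
have y0 : (y : K) != 0 by rewrite -normr_eq0 y1 oner_eq0.
exists ((x : K) / y); first by rewrite /unimodular /= normf_div x1 y1 divr1.
change (`|(x : K) + x / y * y| = 2).
by rewrite divfK// -mulr2n normrMn x1.
Qed.

End OneDimensional.

Theorem proposition3p1 (R : realType) (k : scalar_kind) :
  (finite_dimensional (scalar_space R k) /\
   super_ADP (scalar_space R k) /\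
   forall X : completeNormedModType (scalar_field R k),
     nonzero_space X -> finite_dimensional X -> super_ADP X ->
     isometrically_isomorphic X (scalar_space R k))
  /\
  (super_ADP (scalar_space R k) /\
   Kadec (scalar_space R k) /\
   forall X : completeNormedModType (scalar_field R k),
     nonzero_space X -> super_ADP X -> Kadec X ->
     isometrically_isomorphic X (scalar_space R k)).
Proof.
have fK := @scalar_space_finite_dimensional R k.
have aK := @scalar_space_super_ADP R k.
have kK : Kadec (scalar_space R k) by exact: finite_dimensional_Kadec.
split; do 2![split=> //].
(* Finite dimension forces the Kadec property, so this uniqueness claim is a case of the other
   one. *)
- by move=> X X0 /finite_dimensional_Kadec kX aX; exact: super_ADP_Kadec_scalar.
- by move=> X; exact: super_ADP_Kadec_scalar.
Qed.
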